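(* In the setting of the context (abstract proximal discontinuous Galerkin method), for every $k\ge 1$ and given $\psi_h^{k-1}\in W_h$ and $\alpha_k>0$, there exists a unique pair $(u_h^k,\psi_h^k)\in V_h\times W_h$ such that, with $\lambda_h^k:=(\psi_h^{k-1}-\psi_h^k)/\alpha_k$, $$a_h(u_h^k,v_h)-(\mathsf{p}(v_h),\lambda_h^k)=(f,\mathsf{p}(v_h))\quad\forall v_h\in V_h,$$ $$(\mathsf{p}(u_h^k),w_h)-(\nabla\mathcal{R}^*(\psi_h^{k-1}-\alpha_k\lambda_h^k),w_h)=0\quad\forall w_h\in W_h.$$
   Context: Problem data. $\Omega\subset\mathbb{R}^n$, $n\in\{2,3\}$, is an open bounded Lipschitz domain, $(\cdot,\cdot)$ is the $L^2(\Omega)$ inner product, $f\in L^2(\Omega)$, and $\phi\in H^1(\Omega)\cap C^0(\overline\Omega)$ with $\phi\le 0$ on $\partial\Omega$. Set $\mathcal{O}:=\{o\in L^2(\Omega): o(x)\in[\phi(x),\infty)\text{ for a.e. }x\}$. Legendre function. $R:\Omega\times\mathbb{R}\to\mathbb{R}\cup\{+\infty\}$ is a Carathéodory function such that for a.e. $x$ the map $R(x,\cdot)$ is a Legendre function with essential domain $[\phi(x),\infty)$ (proper, strictly convex, differentiable on the interior of its essential domain, with gradient singular only at the boundary of the domain) and supercoercive ($R(x,y)/|y|\to\infty$ as $|y|\to\infty$). $R^*(x,z):=\sup_{y\in\mathbb{R}}\{zy-R(x,y)\}$ is the convex conjugate, which is continuously differentiable and strictly convex in $z$; $\mathcal{R}^*(\psi)(x):=R^*(x,\psi(x))$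 and $\nabla\mathcal{R}^*(\psi)(x):=\partial_zR^*(x,\psi(x))$. Standing facts: $\nabla\mathcal{R}^*$ maps $L^\infty(\Omega)$ into $\mathcal{O}$, with $\nabla\mathcal{R}^*(\psi)>\phi$ a.e.; it is continuous on $L^\infty(\Omega)$ and strictly monotone: $(\nabla\mathcal{R}^*(\psi)-\nabla\mathcal{R}^*(\xi),\psi-\xi)\ge 0$ for all $\psi,\xi\in L^\infty(\Omega)$, with equality iff $\psi=\xi$. Mesh and spaces. $\mathcal{T}_h$ is a conforming shape-regular simplicial partition of $\Omega$, with interior facets $\mathcal{F}_h$ and boundary facets $\mathcal{F}_h^\partial$; $h_F$ is the diameter of $F$; $[v]$ is the jump of $v$ across an interior facet and its trace on a boundary facet. $H^1(\mathcal{T}_h)$ is the broken $H^1$-space, $\|v\|_{\mathrm{DG}}^2:=\sum_{T\in\mathcal{T}_h}\|\nabla v\|_{L^2(T)}^2+\sum_{F\in\mathcal{F}_h\cup\mathcal{F}_h^\partial}h_F^{-1}\|[v]\|_{L^2(F)}^2$, and $\mathbb{P}^p(\mathcal{T}_h)$ is the space of functions that are polynomials of degree at most $p$ on each $T$. Abstract discretization. $V_h$ is a finite-dimensional real vector space with norm $\|\cdot\|_{V_h}$, $W_h:=\mathbb{P}^0(\mathcal{T}_h)$, $V_{\mathcal{T}_h}$ is a space with $\mathbb{P}^0(\mathcal{T}_h)\subseteq V_{\mathcal{T}_h}\subseteq\mathbb{P}^1(\mathcal{T}_h)$, $\mathsf{p}:V_h\to V_{\mathcal{T}_h}$ is linear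 with $W_h\subseteq\mathsf{p}(V_h)$, and $a_h:V_h\times V_h\to\mathbb{R}$ is a symmetric bilinear form. Assume there are positive constants such that: (i) $a_h(v_h,v_h)\ge C_{\mathrm{coerc}}\|v_h\|_{V_h}^2$ and $a_h(v_h,z_h)\le C_{\mathrm{cont}}\|v_h\|_{V_h}\|z_h\|_{V_h}$ for all $v_h,z_h\in V_h$; (ii) $\|\mathsf{p}(v_h)\|_{\mathrm{DG}}\le C_{\mathsf{p}}\|v_h\|_{V_h}$ for all $v_h\in V_h$; (iii) there is a linear map $\Pi_h:H^1(\mathcal{T}_h)\to V_h$ such that, with $J_h:=\mathsf{p}\circ\Pi_h$, for all $v\in H^1(\mathcal{T}_h)$: $(J_hv-v,w_h)=0$ for all $w_h\in W_h$, and $\|\Pi_hv\|_{V_h}\le C_\Pi\|v\|_{\mathrm{DG}}$. *)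

(* Defs.v *)
From HB Require Import structures.
From mathcomp Require Import all_boot all_order all_algebra.
From mathcomp Require Import all_classical all_reals all_analysis.
From mathcomp Require Import measurable_realfun.

Set Implicit Arguments.
Unset Strict Implicit.
Unset Printing Implicit Defensive.

Import Order.TTheory GRing.Theory Num.Theory.
Import numFieldNormedType.Exports.

Local Open Scope classical_set_scope.
Local Open Scope ring_scope.

(* 'rV[R]_n carries the sigma-algebra generated by the coordinates, i.e. the
   Borel sigma-algebra; this mirrors the library's instance on n.-tuple. *)
Section measurable_rV.
Context (R : realType) (n : nat).

Definition rV_coord (i : 'I_n) (x : 'rV[R]_n) : measurableTypeR R := x ord0 i.

Let rV_set0 : g_sigma_preimage rV_coord set0.
Proof. exact: sigma_algebra0. Qed.

Let rV_setC A : g_sigma_preimage rV_coord A -> g_sigma_preimage rV_coord (~` A).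
Proof. exact: sigma_algebraC. Qed.

Let rV_bigcup (F : _^nat) : (forall i, g_sigma_preimage rV_coord (F i)) ->
  g_sigma_preimage rV_coord (\bigcup_i (F i)).
Proof. exact: sigma_algebra_bigcup. Qed.

HB.instance Definition _ := @isMeasurable.Build default_measure_display
  'rV[R]_n (g_sigma_preimage rV_coord) rV_set0 rV_setC rV_bigcup.

End measurable_rV.

Lemma measurable_rV_coord (R : realType) n (i : 'I_n) :
  measurable_fun [set: 'rV[R]_n] (@rV_coord R n i).
Proof.
move=> _ Y mY; rewrite setTI; apply: sub_sigma_algebra => /=.
rewrite -bigcup_seq/=; exists i => /=; first by rewrite mem_index_enum.
by exists Y => //; rewrite setTI.
Qed.

Lemma measurable_fun_rVP d (T : measurableType d) (R : realType) n
    (f : T -> 'rV[R]_n) :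
  (forall i, measurable_fun [set: T] (@rV_coord R n i \o f)) ->
  measurable_fun [set: T] f.
Proof.
move=> mf.
have prefS : g_sigma_preimage (fun i => @rV_coord R n i \o f) `<=` measurable.
  apply: smallest_sub; first exact: sigma_algebra_measurable.
  case: n => [|n] in f mf *; first by rewrite big_ord0.
  rewrite -bigcup_mkord_ord; apply: bigcup_sub => i Ii.
  by move=> A [B mB <-]; exact: mf.
rewrite g_sigma_preimage_comp in prefS.
by move=> _ A mA; apply: prefS; exists A.
Qed.

Section lebesgue_rV.
Context (R : realType).

Definition consrV n (z : measurableTypeR R * 'rV[R]_n) : 'rV[R]_n.+1 :=
  row_mx (const_mx z.1 : 'rV[R]_1) z.2.

Definition unconsrV n (x : 'rV[R]_n.+1) : measurableTypeR R * 'rV[R]_n :=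
  (x ord0 ord0, rsubmx (x : 'rV[R]_(1 + n))).

Lemma unconsrVK n : cancel (@unconsrV n) (@consrV n).
Proof.
move=> x; rewrite /consrV /unconsrV /= -[RHS](@hsubmxK _ 1 1 n).
apply: (f_equal (fun a : 'rV[R]_1 => row_mx a _)).
by apply/matrixP => i j; rewrite !mxE !ord1; congr (x _ _); apply/val_inj.
Qed.

Lemma consrVK n : cancel (@consrV n) (@unconsrV n).
Proof.
move=> [a y]; rewrite /consrV /unconsrV /= row_mxKr; congr pair.
rewrite (_ : (ord0 : 'I_n.+1) = lshift n (ord0 : 'I_1)); last exact/val_inj.
by rewrite (@row_mxEl _ 1 1 n) mxE.
Qed.

Lemma measurable_consrV n : measurable_fun setT (@consrV n).
Proof.
apply: measurable_fun_rVP => i.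
case: (@split_ordP 1 n i) => j ->.
  rewrite (_ : _ \o _ = fst) //; apply/funext => -[a y] /=.
  by rewrite /rV_coord /consrV (@row_mxEl _ 1 1 n) mxE.
rewrite (_ : _ \o _ = @rV_coord R n j \o snd).
  by apply: measurableT_comp => //; exact: measurable_rV_coord.
by apply/funext => -[a y] /=; rewrite /rV_coord /consrV (@row_mxEr _ 1 1 n).
Qed.

Lemma measurable_unconsrV n : measurable_fun setT (@unconsrV n).
Proof.
apply/measurable_fun_pairP; split.
  exact: (@measurable_rV_coord R n.+1 ord0).
apply: measurable_fun_rVP => i.
rewrite (_ : _ \o _ = @rV_coord R n.+1 (rshift 1 i)).
  exact: measurable_rV_coord.
by apply/funext => x /=; rewrite /rV_coord /unconsrV /= mxE.
Qed.

Section step.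
Context n (mu : {sigma_finite_measure set 'rV[R]_n -> \bar R}).

Definition leb_step := pushforward (@lebesgue_measure R \x mu)%E (@consrV n).

Let leb_step0 : leb_step set0 = 0%E.
Proof. by rewrite /leb_step /pushforward preimage_set0 measure0. Qed.

Let leb_step_ge0 A : (0 <= leb_step A)%E.
Proof. by rewrite /leb_step /pushforward; exact: measure_ge0. Qed.

Let leb_step_sigma_additive : semi_sigma_additive leb_step.
Proof.
exact: (@measure_semi_sigma_additive _ _ _
  (@measure_function_pushforward__canonical__measure_function_Measure
     _ _ _ _ _ (@lebesgue_measure R \x mu)%E _ (@measurable_consrV n))).
Qed.

HB.instance Definition _ := isMeasure.Build _ _ _ leb_step
  leb_step0 leb_step_ge0 leb_step_sigma_additive.

Let leb_step_sigma_finite : sigma_finite setT leb_step.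
Proof.
have /sigma_finiteP[F [TF ndF Foo]] := sigma_finiteT (@lebesgue_measure R).
have /sigma_finiteP[G [TG ndG Goo]] := sigma_finiteT mu.
exists (fun k => @unconsrV n @^-1` (F k `*` G k)).
  rewrite -preimage_bigcup -(@preimage_setT _ _ (@unconsrV n)); congr preimage.
  rewrite -setXTT TF TG predeqE => -[x y]; split.
    move=> [/= [i _ Fix] [k _ Gky]]; exists (maxn i k) => //; split.
    - by move: x Fix; exact/subsetPset/ndF/leq_maxl.
    - by move: y Gky; exact/subsetPset/ndG/leq_maxr.
  by move=> [i _ []/= ? ?]; split; exists i.
move=> k; have [? ?] := Foo k; have [? ?] := Goo k.
have mFG : measurable (F k `*` G k) by exact: measurableX.
split; first by rewrite -[X in measurable X]setTI; exact: measurable_unconsrV.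
rewrite /leb_step /pushforward -comp_preimage.
rewrite (_ : @unconsrV n \o @consrV n = id); last first.
  by apply/funext => z /=; exact: consrVK.
by rewrite preimage_id product_measure1E// lte_mul_pinfty// ge0_fin_numE.
Qed.

HB.instance Definition _ := Measure_isSigmaFinite.Build _ _ _ leb_step
  leb_step_sigma_finite.

End step.

(* Lebesgue measure on R^n: the iterated product of the measure on R. *)
Fixpoint leb n : {sigma_finite_measure set 'rV[R]_n -> \bar R} :=
  match n with
  | 0 => \d_ (0 : 'rV[R]_0)
  | k.+1 => leb_step (leb k)
  end.

End lebesgue_rV.
Section sobolev.
Context (R : realType) (n : nat).
Local Notation E := 'rV[R]_n.
Implicit Types (D : set E) (u v g : E -> R).

Definition dot (x y : E) : R := \sum_i x ord0 i * y ord0 i.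

(* The library norm of 'rV[R]_n is the sup norm. *)
Definition enorm (x : E) : R := Num.sqrt (dot x x).

Definition diam D : R := sup [set enorm (x - y) | x in D & y in D].

(* Functions on D are the restrictions of functions on R^n: only their values
   on D matter, and v \_ D is the extension by zero. *)
Definition Lp D (p : \bar R) v : Prop := v \_ D \in Lfun (leb R n) p.

Definition Lp_norm D (p : \bar R) v : \bar R :=
  ('N[leb R n]_p [EFin \o (v \_ D)])%E.

Definition ip D u v : R := \int[leb R n]_(x in D) (u x * v x).

Definition partial (i : 'I_n) (f : E -> R) : E -> R :=
  'D_(delta_mx ord0 i) f.

Fixpoint Ck (k : nat) (f : E -> R) : Prop :=
  match k with
  | 0 => continuous f
  | j.+1 => continuous f /\ forall i : 'I_n,
      (forall x, derivable f x (delta_mx ord0 i)) /\ Ck j (partial i f)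
  end.

Definition smooth (f : E -> R) : Prop := forall k, Ck k f.

Definition test_fun D (th : E -> R) : Prop :=
  smooth th /\
  exists K, [/\ compact K, K `<=` D & forall x, ~ K x -> th x = 0].

Definition weak_partial D (i : 'I_n) v g : Prop :=
  forall th, test_fun D th -> ip D v (partial i th) = - ip D g th.

Definition H1 D v : Prop := Lp D 2%:E v /\
  forall i, exists g, Lp D 2%:E g /\ weak_partial D i v g.

(* i-th component of the weak gradient (unique up to a null set) *)
Definition wgrad D v (i : 'I_n) : E -> R :=
  xget (fun=> 0) [set g | Lp D 2%:E g /\ weak_partial D i v g].

(* Near each boundary point x0, and up to a rigid motion, D is the strict
   epigraph of a Lipschitz function: nu is the vertical axis, and x - (x.nu) nu
   is the component of x in the hyperplane nu^perp. *)
Definition lipschitz_domain D : Prop :=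
  [/\ open D, connected D, D !=set0, bounded_set D &
    forall x0, (closure D `\` D) x0 ->
      exists (nu : E) (gam : E -> R) (L r : R),
        [/\ enorm nu = 1, L.-lipschitz gam, 0 < r &
          forall x, enorm (x - x0) < r ->
            (D x <-> gam (x - dot x nu *: nu) < dot x nu)]].

End sobolev.

Section simplex.
Context (R : realType) (n : nat).

(* The rows of S : 'M_(k, n) are the vertices of a simplex; [face S A] is the
   face spanned by the vertices with index in A (it is empty for A = set0). *)
Definition face k (S : 'M[R]_(k, n)) (A : {set 'I_k}) : set 'rV[R]_n :=
  [set x | exists l : 'rV[R]_k,
    [/\ forall i, 0 <= l ord0 i, forall i, i \notin A -> l ord0 i = 0,
        \sum_i l ord0 i = 1 & x = l *m S]].

Definition hull k (S : 'M[R]_(k, n)) : set 'rV[R]_n := face S [set: 'I_k]%SET.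

Definition open_simplex k (S : 'M[R]_(k, n)) : set 'rV[R]_n :=
  [set x | exists l : 'rV[R]_k,
    [/\ forall i, 0 < l ord0 i, \sum_i l ord0 i = 1 & x = l *m S]].

Definition edges k (S : 'M[R]_(k.+1, n)) : 'M[R]_(k, n) :=
  \matrix_(j, c) (S (lift ord0 j) c - S ord0 c).

(* Surface integration over a k-simplex in R^n: affine parametrization by the
   reference simplex of R^k, with the Gram determinant as area element. *)
Definition ref_simplex k : set 'rV[R]_k :=
  [set t | (forall j, 0 <= t ord0 j) /\ \sum_j t ord0 j <= 1].
Arguments ref_simplex : clear implicits.

Definition simplex_param k (S : 'M[R]_(k.+1, n)) (t : 'rV[R]_k) : 'rV[R]_n :=
  row ord0 S + t *m edges S.

Definition L2_surf k (S : 'M[R]_(k.+1, n)) (g : 'rV[R]_n -> R) : Prop :=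
  Lp (ref_simplex k) 2%:E (g \o simplex_param S).

Definition surf_sqnorm k (S : 'M[R]_(k.+1, n)) (g : 'rV[R]_n -> R) : R :=
  Num.sqrt (\det (edges S *m (edges S)^T)) *
  \int[leb R k]_(t in ref_simplex k) (g (simplex_param S t)) ^+ 2.

End simplex.

Section mesh.
Context (R : realType) (m : nat).
Local Notation n := m.+1.
Local Notation E := 'rV[R]_n.
Context (Th : finType) (X : Th -> 'M[R]_(n.+1, n)).

Definition elt (K : Th) : set E := open_simplex (X K).

(* shape regularity: sigma bounds diameter / inscribed-ball diameter *)
Definition simplicial_mesh (Omega : set E) (sigma : R) : Prop :=
  [/\ forall K, \det (edges (X K)) != 0,
      closure Omega = \bigcup_(K in [set: Th]) hull (X K),
      forall K K', K != K' -> elt K `&` elt K' = set0,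
      forall K K', exists A A', face (X K) A = face (X K') A' /\
        hull (X K) `&` hull (X K') = face (X K) A &
      forall K, exists (c : E) (r : R), [/\ 0 < r,
        [set x | enorm (x - c) < r] `<=` hull (X K) &
        diam (hull (X K)) <= sigma * (2 * r)]].

Definition poly_fun (p : nat) (c : {ffun 'I_n -> 'I_p.+1} -> R) (x : E) : R :=
  \sum_(a : {ffun 'I_n -> 'I_p.+1} | (\sum_i a i <= p)%N)
    c a * \prod_i x ord0 i ^+ a i.

(* P^p(T_h) consists of classes modulo null sets; each class is encoded by its
   unique representative that vanishes off the union of the open elements, so
   that equality of functions is equality in P^p(T_h). *)
Definition broken_poly (p : nat) (v : E -> R) : Prop :=
  (forall K, exists c, forall x, elt K x -> v x = @poly_fun p c x) /\
  (forall x, (forall K, ~ elt K x) -> v x = 0).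

Definition broken_H1 (Omega : set E) (v : E -> R) : Prop :=
  Lp Omega 2%:E v /\ forall K, H1 (elt K) v.

(* (K, i) stands for the facet of K opposite to its i-th vertex. *)
Definition facet_mx (Ki : Th * 'I_n.+1) : 'M[R]_(n, n) := row' Ki.2 (X Ki.1).

Definition facets : set (set E) :=
  [set F | exists Ki, F = hull (facet_mx Ki)].

(* The elements having F as a facet: two if F is interior, one if F lies on
   the boundary. *)
Definition facet_elts (F : set E) : seq (Th * 'I_n.+1) :=
  enum [pred Ki | `[< hull (facet_mx Ki) = F >]].

(* Trace on a facet of v in H^1(K): limit of the restrictions of smooth
   functions converging to v in H^1(K). *)
Definition is_trace (Ki : Th * 'I_n.+1) (v g : E -> R) : Prop :=
  L2_surf (facet_mx Ki) g /\
  exists th : nat -> E -> R,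
    [/\ forall j, smooth (th j),
        Lp_norm (elt Ki.1) 2%:E (th j \- v) @[j --> \oo] --> 0%E,
        forall i, Lp_norm (elt Ki.1) 2%:E
          (partial i (th j) \- wgrad (elt Ki.1) v i) @[j --> \oo] --> 0%E &
        surf_sqnorm (facet_mx Ki) (th j \- g) @[j --> \oo] --> (0 : R)].

Definition trace (Ki : Th * 'I_n.+1) (v : E -> R) : E -> R :=
  xget (fun=> 0) [set g | is_trace Ki v g].

(* h_F^{-1} ||[v]||^2_{L^2(F)}; the orientation of the jump across an interior
   facet does not affect its norm. *)
Definition facet_term (F : set E) (v : E -> R) : R :=
  match facet_elts F with
  | [::] => 0
  | [:: Ki] => (diam F)^-1 * surf_sqnorm (facet_mx Ki) (trace Ki v)
  | Ki :: Ki' :: _ =>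
      (diam F)^-1 * surf_sqnorm (facet_mx Ki) (trace Ki v \- trace Ki' v)
  end.

Definition DG_norm (v : E -> R) : R :=
  Num.sqrt (\sum_K \sum_i \int[leb R n]_(x in elt K) (wgrad (elt K) v i x) ^+ 2
            + \sum_(F \in facets) facet_term F v).

End mesh.

Section legendre.
Context (R : realType).
Implicit Type F : R -> \bar R.

Definition edom F : set R := [set y | (F y < +oo)%E].

Definition legendre F : Prop :=
  [/\ (forall y, F y != -oo%E) /\ edom F !=set0,
      forall y z t : R, edom F y -> edom F z -> y != z -> 0 < t < 1 ->
        (F (t * y + (1 - t) * z)%R < t%:E * F y + (1 - t)%R%:E * F z)%E,
      forall y, (edom F)° y -> derivable (fine \o F) y 1 &
      forall b, closure (edom F) b -> ~ (edom F)° b ->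
        `|derive1 (fine \o F) y| @[y --> within (edom F)° (nbhs b)] --> +oo].

Definition supercoercive F : Prop :=
  forall M, exists C, forall y, C < `|y| -> ((M * `|y|)%:E <= F y)%E.

Definition conjugate F (z : R) : \bar R :=
  ereal_sup [set ((z * y)%:E - F y)%E | y in [set: R]].

End legendre.

Section obstacle.
Context (R : realType) (n : nat).
Local Notation E := 'rV[R]_n.
Context (Omega : set E) (phi : E -> R) (Rf : E -> R -> \bar R).

Definition admissible (o : E -> R) : Prop :=
  Lp Omega 2%:E o /\ {ae leb R n, forall x, Omega x -> phi x <= o x}.

(* Since R(x, .) jumps to +oo at phi(x), continuity in the Caratheodory
   condition is understood on the essential domain. *)
Definition caratheodory : Prop :=
  (forall y, measurable_fun Omega (Rf ^~ y)) /\
  {ae leb R n, forall x, Omega x ->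
    {within edom (Rf x), continuous (fine \o Rf x)}}.

Definition legendre_integrand : Prop :=
  {ae leb R n, forall x, Omega x ->
    [/\ legendre (Rf x), edom (Rf x) = [set y | phi x <= y] & supercoercive (Rf x)]}.

Definition grad_conj (psi : E -> R) (x : E) : R :=
  derive1 (fine \o conjugate (Rf x)) (psi x).

Definition grad_conj_range : Prop :=
  forall psi, Lp Omega +oo%E psi ->
    admissible (grad_conj psi) /\
    {ae leb R n, forall x, Omega x -> phi x < grad_conj psi x}.

(* continuity from L^oo(Omega) to L^2(Omega) *)
Definition grad_conj_continuous : Prop :=
  forall psi, Lp Omega +oo%E psi -> forall eps : R, 0 < eps ->
    exists2 delta : R, 0 < delta &
      forall xi, Lp Omega +oo%E xi ->
        (Lp_norm Omega +oo%E (xi \- psi)%R <= delta%:E)%E ->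
        (Lp_norm Omega 2%:E (grad_conj xi \- grad_conj psi)%R <= eps%:E)%E.

Definition grad_conj_strictly_monotone : Prop :=
  forall psi xi, Lp Omega +oo%E psi -> Lp Omega +oo%E xi ->
    let d := ip Omega (grad_conj psi \- grad_conj xi) (psi \- xi) in
    0 <= d /\
    (d = 0 <-> {ae leb R n, forall x, Omega x -> psi x = xi x}).

End obstacle.

Definition is_norm (R : realType) (V : lmodType R) (N : V -> R) : Prop :=
  [/\ forall v, 0 <= N v, forall v, N v = 0 -> v = 0,
      forall (a : R) v, N (a *: v) = `|a| * N v &
      forall u v, N (u + v) <= N u + N v].

(* Main.v *)
Require Import Defs.
From HB Require Import structures.
From mathcomp Require Import all_boot all_order all_algebra.
From mathcomp Require Import all_classical all_reals all_analysis.
From mathcomp Require Import measurable_realfun ess_sup_inf.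
From mathcomp Require Import ring lra.

(* W_h consists of the functions sum_K c_K 1_K, so the second equation only
   involves g_K(c) = (grad R^*(psi), 1_K), a continuous monotone map of R^{T_h}.
   Eliminating u through the Riesz representatives z_K of v |-> (p v, 1_K) for a_h
   leaves g(c) + G c = b, where G is 1/alpha times the Gram matrix of the z_K.
   Because W_h is contained in the range of p, G is positive definite; the map
   c |-> g(c) + G c is thus continuous and strongly monotone, hence onto.
   Testing the difference of two solutions with itself gives u = u' by coercivity,
   and then psi = psi' because W_h is contained in the range of p. *)

Set Implicit Arguments.
Unset Strict Implicit.
Unset Printing Implicit Defensive.

Import Order.TTheory GRing.Theory Num.Theory.
Import numFieldNormedType.Exports.

Local Open Scope classical_set_scope.
Local Open Scope ring_scope.

(** * Strongly monotone maps of R^n *)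

(** Comparing [T] and [- T] with 0 shows that [g] has grown by at least [c * T] on either side; [T]
    is chosen so that this equals the modulus of [g 0]. Hence [g] changes sign on [-T, T]. *)
Lemma strongly_monotone_root (R : realType) (g : R -> R) (c : R) : 0 < c ->
  continuous g ->
  (forall s t, c * (s - t) ^+ 2 <= (g s - g t) * (s - t)) ->
  exists t, g t = 0.
Proof.
move=> c0 gc gm; pose T := `|g 0| / c.
have T0 : 0 <= T by rewrite divr_ge0// ltW.
have cT : c * T = `|g 0| by rewrite mulrC divfK// gt_eqF.
have [T_eq0|T_neq0] := eqVneq T 0.
  by exists 0; apply/eqP; rewrite -normr_eq0 -cT T_eq0 mulr0.
have Tp : 0 < T by rewrite lt_def T_neq0.
have gT : 0 <= g T.
  have : c * T <= g T - g 0.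
    by rewrite -(ler_pM2r Tp); have := gm T 0; rewrite subr0 expr2 mulrA.
  have := ler_norm (- g 0); rewrite normrN; lra.
have gNT : g (- T) <= 0.
  have : c * T <= g 0 - g (- T).
    by rewrite -(ler_pM2r Tp); have := gm 0 (- T); rewrite sub0r opprK expr2 mulrA.
  have := ler_norm (g 0); lra.
have [| ||t _ gt0] := @IVT R g (- T) T 0; last by exists t.
- lra.
- exact: continuous_subspaceT.
- by rewrite ge_min le_max gNT gT orbT.
Qed.

Definition ord_cons (R : Type) n (t : R) (x : 'I_n -> R) (i : 'I_n.+1) : R :=
  oapp x t (unlift ord0 i).

Lemma ord_cons0 (R : Type) n (t : R) (x : 'I_n -> R) : ord_cons t x ord0 = t.
Proof. by rewrite /ord_cons unlift_none. Qed.

Lemma ord_cons_lift (R : Type) n (t : R) (x : 'I_n -> R) i :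
  ord_cons t x (lift ord0 i) = x i.
Proof. by rewrite /ord_cons liftK. Qed.

(** Epsilon-delta continuity for the sup distance on families of reals. The bounds are non-strict,
    in the style of [grad_conj_continuous]. *)
Definition coordwise_continuous (R : realType) (I : Type)
    (F : (I -> R) -> I -> R) : Prop :=
  forall x e, 0 < e -> exists2 d, 0 < d & forall y,
    (forall i, `|y i - x i| <= d) -> forall i, `|F y i - F x i| <= e.

(* The first coordinate is eliminated by the intermediate value theorem; strong
   monotonicity makes the solved coordinate depend continuously on the others. *)
Lemma strongly_monotone_zero_ord (R : realType) n
    (F : ('I_n -> R) -> 'I_n -> R) (c : R) :
  0 < c -> coordwise_continuous F ->
  (forall x y, c * \sum_i (x i - y i) ^+ 2
               <= \sum_i (F x i - F y i) * (x i - y i)) ->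
  exists x, forall i, F x i = 0.
Proof.
move=> c0; elim: n => [|n IH] in F *; first by exists (fun=> 0); case.
move=> Fc Fm.
(* For two points that differ only in the first coordinate all other terms vanish, so the first
   component is strongly monotone in its own variable, with the same [c]. *)
have Fm0 x s t : c * (s - t) ^+ 2
    <= (F (ord_cons s x) ord0 - F (ord_cons t x) ord0) * (s - t).
  have := Fm (ord_cons s x) (ord_cons t x).
  rewrite !big_ord_recl !ord_cons0 !big1 ?addr0 // => i _.
    by rewrite !ord_cons_lift subrr mulr0.
  by rewrite !ord_cons_lift subrr expr0n.
have /choice[s sP] : forall x : 'I_n -> R, exists t, F (ord_cons t x) ord0 = 0.
  move=> x; apply: (strongly_monotone_root c0 _ (Fm0 x)) => t.
  apply/cvgrPdist_le => e e0; have [d d0 Fd] := Fc (ord_cons t x) e e0.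
  near=> t'; rewrite distrC; apply: Fd => i.
  have [j ->|->] := unliftP ord0 i.
    by rewrite !ord_cons_lift subrr normr0 ltW.
  rewrite !ord_cons0 distrC; near: t'; exact: cvgr_dist_le.
have [||x xP] := IH (fun x i => F (ord_cons (s x) x) (lift ord0 i)).
- move=> x e e0; have [d d0 Fd] := Fc (ord_cons (s x) x) e e0.
  (* Strong monotonicity bounds [c] times the distance of [s x] and [s y] by the first component at
     [(s x, y)]. This component is zero at [(s x, x)], so a change of at most [c * d] moves [s] by
     at most [d]. *)
  have [d' d'0 Fd'] := Fc (ord_cons (s x) x) (c * d) (mulr_gt0 c0 d0).
  exists (Num.min d d') => [|y yx i]; first by rewrite lt_min d0.
  apply: Fd => {i} i; have [j ->|->] := unliftP ord0 i.
    by rewrite !ord_cons_lift (le_trans (yx j))// ge_min lexx.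
  rewrite !ord_cons0; have [->|sxy] := eqVneq (s y) (s x).
    by rewrite subrr normr0 ltW.
  have sxy0 : 0 < `|s x - s y| by rewrite normr_gt0 subr_eq0 eq_sym.
  rewrite distrC -(ler_pM2l c0) -(ler_pM2r sxy0).
  rewrite -mulrA -normrM -expr2 ger0_norm ?sqr_ge0//.
  apply: (le_trans (Fm0 y _ _)); rewrite sP subr0.
  apply: (le_trans (ler_norm _)); rewrite normrM ler_wpM2r//.
  rewrite -[X in `|X|]subr0 -(sP x); apply: Fd' => i'.
  have [j ->|->] := unliftP ord0 i'.
    by rewrite !ord_cons_lift (le_trans (yx j))// ge_min lexx orbT.
  by rewrite !ord_cons0 subrr normr0 ltW.
(* The first component is zero at both solved points, so its term leaves the right-hand side; on the
   left the square of [s x - s y] is simply dropped. *)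
- move=> x y; have := Fm (ord_cons (s x) x) (ord_cons (s y) y).
  rewrite !big_ord_recl !sP subrr mul0r add0r !ord_cons0.
  under eq_bigr do rewrite !ord_cons_lift.
  under [X in _ <= X -> _]eq_bigr do rewrite !ord_cons_lift.
  by apply: le_trans; rewrite ler_pM2l// lerDr sqr_ge0.
exists (ord_cons (s x) x) => i; have [j ->|->] := unliftP ord0 i; first exact: xP.
exact: sP.
Unshelve. all: by end_near. Qed.

Lemma strongly_monotone_zero (R : realType) (I : finType)
    (F : (I -> R) -> I -> R) (c : R) :
  0 < c -> coordwise_continuous F ->
  (forall x y, c * \sum_i (x i - y i) ^+ 2
               <= \sum_i (F x i - F y i) * (x i - y i)) ->
  exists x, forall i, F x i = 0.
Proof.
move=> c0 Fc Fm.
pose G (x : 'I_#|I| -> R) j := F (x \o @enum_rank I) (@enum_val I I j).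
have [||x xP] := @strongly_monotone_zero_ord R _ G c c0.
- move=> x e e0; have [d d0 Fd] := Fc (x \o enum_rank) e e0.
  by exists d => // y yx i; apply: Fd => j; exact: yx.
- move=> x y; have := Fm (x \o enum_rank) (y \o enum_rank).
  rewrite !(reindex (@enum_val I I))/=; last 2 first.
  + by exists enum_rank => i _; rewrite (enum_valK, enum_rankK).
  + by exists enum_rank => i _; rewrite (enum_valK, enum_rankK).
  under eq_bigr do rewrite enum_valK.
  by under [X in _ <= X -> _]eq_bigr do rewrite enum_valK.
exists (x \o enum_rank) => i; by have := xP (enum_rank i); rewrite /G enum_rankK.
Qed.

(** The coercive matrix supplies all the strong monotonicity, and adding the monotone [g] preserves
    it; a zero of [g x + B x - b] is then sought. *)
Lemma monotone_linear_solve (R : realType) (I : finType)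
    (g : (I -> R) -> I -> R) (B : I -> I -> R) (b : I -> R) (c : R) :
  0 < c -> coordwise_continuous g ->
  (forall x y, 0 <= \sum_i (g x i - g y i) * (x i - y i)) ->
  (forall x, c * \sum_i x i ^+ 2 <= \sum_i (\sum_j B i j * x j) * x i) ->
  exists x, forall i, g x i + \sum_j B i j * x j = b i.
Proof.
move=> c0 gc gm Bc.
pose F x i := g x i + \sum_j B i j * x j - b i.
have FE x y i : F x i - F y i
    = (g x i - g y i) + \sum_j B i j * (x j - y j).
  under eq_bigr do rewrite mulrBr.
  by rewrite sumrB /F; ring.
have [||x xP] := strongly_monotone_zero (F := F) c0.
- move=> x e e0; have e20 : 0 < e / 2 by rewrite divr_gt0.
  have [d d0 gd] := gc x (e / 2) e20.
  (* [S] dominates every absolute row sum of [B], so moving each coordinate by at most [e / 2 / S]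
     changes the linear part by at most [e / 2]. The added 1 makes [S] positive. *)
  pose S := \sum_i \sum_j `|B i j| + 1.
  have S0 : 0 < S by rewrite ltr_wpDl// !sumr_ge0// => i _; rewrite sumr_ge0.
  exists (Num.min d (e / 2 / S)); first by rewrite lt_min d0 divr_gt0.
  move=> y yx i; rewrite FE (splitr e) (le_trans (ler_normD _ _))// lerD//.
    by apply: gd => j; rewrite (le_trans (yx j))// ge_min lexx.
  apply: (le_trans (ler_norm_sum _ _ _)).
  apply: (@le_trans _ _ (\sum_j `|B i j| * (e / 2 / S))).
    apply: ler_sum => j _; rewrite normrM ler_wpM2l// (le_trans (yx j))//.
    by rewrite ge_min lexx orbT.
  rewrite -mulr_suml mulrA ler_pdivrMr// [leLHS]mulrC ler_pM2l//.
  rewrite /S [X in _ <= X + 1](bigD1 i)//= -addrA lerDl addr_ge0// sumr_ge0// => j _.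
  by rewrite sumr_ge0.
- move=> x y; apply: (le_trans (Bc (fun i => x i - y i))).
  under [leRHS]eq_bigr do rewrite FE mulrDl.
  by rewrite big_split/= lerDr gm.
by exists x => i; apply/eqP; rewrite -subr_eq0; apply/eqP; exact: xP.
Qed.

(** * The mixed problem in finite dimension *)

Section riesz.
Import VectorInternalTheory.

(** Definiteness makes the Gram matrix [A] of a basis invertible: if [r A = 0], then [r] is
    orthogonal to every basis vector, hence to itself. The coordinates of the representative are the
    values of [l] on the basis times the inverse of [A]. *)
Lemma biscalar_riesz (F : fieldType) (V : vectType F) (a : {biscalar V})
    (l : V -> F) :
  scalar l -> (forall v, a v v = 0 -> v = 0) ->
  exists u, forall v, a u v = l v.
Proof.
move=> llin a0; set n := dim V.
pose e (i : 'I_n) : V := @r2v F V (delta_mx 0 i).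
have vE v : v = \sum_i v2r v 0 i *: e i.
  rewrite -[LHS]v2rK {1}(row_sum_delta (v2r v)) linear_sum; apply: eq_bigr => i _.
  by rewrite linearZ.
pose A := \matrix_(i, j) a (e i) (e j).
have aE r j : a (@r2v F V r) (e j) = (r *m A) 0 j.
  rewrite (vE (@r2v F V r)) linear_sumlz mxE; apply: eq_bigr => i _.
  by rewrite linearZl_LR r2vK mxE.
have Aunit : row_free A.
  rewrite -kermx_eq0; apply/eqP/row_matrixP => i.
  rewrite row0; have : row i (kermx A) *m A = 0 by rewrite -row_mul mulmx_ker row0.
  move: (row i _) => r rA0.
  have : @r2v F V r = 0.
    apply: a0; rewrite {2}(vE (@r2v F V r)) linear_sumr big1// => j _.
    by rewrite linearZr_LR aE rA0 mxE mulr0.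
  by move/(congr1 v2r); rewrite r2vK linear0.
have lD : forall u v, l (u + v) = l u + l v.
  by move=> u v; have := llin 1 u v; rewrite scale1r mul1r.
have l0 : l 0 = 0 by have := lD 0 0; rewrite addr0 -[X in X = _]addr0 => /addrI.
have lZ c v : l (c *: v) = c * l v.
  by have := llin c v 0; rewrite addr0 l0 addr0.
exists (@r2v F V (\row_j l (e j) *m invmx A)) => v.
rewrite {1}(vE v) linear_sumr [in RHS](vE v).
rewrite (big_morph l lD l0); apply: eq_bigr => j _.
by rewrite linearZr_LR lZ aE mulmxKV -?row_free_unit// mxE.
Qed.

End riesz.

Section mixed_problem.
Context (R : realType) (V : vectType R) (N : V -> R) (a : {biscalar V}).
Context (Ccoerc Ccont : R).
Hypothesis N_norm : is_norm N.
Hypothesis a_sym : forall u v, a u v = a v u.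
Hypothesis Ccoerc_gt0 : 0 < Ccoerc.
Hypothesis a_coerc : forall v, Ccoerc * N v ^+ 2 <= a v v.
Hypothesis a_cont : forall v z, a v z <= Ccont * N v * N z.
Context (I : finType) (q : I -> V -> R) (l : V -> R) (g : (I -> R) -> I -> R).
Context (beta : R).
Hypothesis q_scalar : forall i, scalar (q i).
Hypothesis q_dual : forall i, exists v, forall j, q j v = (j == i)%:R.
Hypothesis l_scalar : scalar l.
Hypothesis beta_gt0 : 0 < beta.
Hypothesis g_cont : coordwise_continuous g.
Hypothesis g_mono : forall x y, 0 <= \sum_i (g x i - g y i) * (x i - y i).

(** The proximal step in coordinates: [c] lists the values of psi on the elements, [q] and [g] are
    the element moments of [p v] and of the conjugate gradient at psi, and [beta] is the inverse of
    alpha. *)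
Definition mixed_solution (u : V) (c : I -> R) : Prop :=
  (forall v, a u v + beta * \sum_i c i * q i v = l v) /\ forall i, q i u = g c i.

Let a_eq0 v : a v v <= 0 -> v = 0.
Proof.
case: N_norm => N0 Neq0 _ _ avv; apply: Neq0; apply/eqP.
rewrite -sqrf_eq0 eq_le sqr_ge0 andbT -(ler_pM2l Ccoerc_gt0) mulr0.
exact: le_trans (a_coerc v) avv.
Qed.

Let sum_dual (c : I -> R) i v : (forall j, q j v = (j == i)%:R) ->
  \sum_j c j * q j v = c i.
Proof.
move=> vi; rewrite (bigD1 i)//= vi eqxx mulr1 big1 ?addr0// => j ji.
by rewrite vi (negPf ji) mulr0.
Qed.

(** [a_cont] bounds [a] only from above; applied to [- z] it also bounds it from below. *)
Let a_normr v z : `|a v z| <= Ccont * N v * N z.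
Proof.
case: N_norm => _ _ NZ _; rewrite ler_norml a_cont andbT lerNl -linearNr.
by rewrite (le_trans (a_cont _ _))// -scaleN1r NZ normrN1 mul1r.
Qed.

Lemma mixed_solution_exists : exists u c, mixed_solution u c.
Proof.
have a0 v : a v v = 0 -> v = 0 by move=> avv; apply: a_eq0; rewrite avv.
have /choice[z zq] : forall i, exists z, forall v, a z v = q i v.
  by move=> i; exact: biscalar_riesz.
have [u0 u0l] := biscalar_riesz l_scalar a0.
have /choice[w wq] := q_dual.
(* With [Z] the combination of the [z i] with coefficients [x], the dual vectors recover [x i] as
   [a Z (w i)], which continuity bounds by [Ccont * N Z * N (w i)]. So the squares of the [x i] sum
   to at most [S * N Z ^+ 2], and coercivity yields the constant [beta * Ccoerc / S]. *)
pose S := \sum_i (Ccont * N (w i)) ^+ 2 + 1.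
have S0 : 0 < S by rewrite ltr_wpDl// sumr_ge0// => i _; rewrite sqr_ge0.
have aZ x v : a (\sum_i x i *: z i) v = \sum_i x i * q i v.
  by rewrite linear_sumlz; apply: eq_bigr => i _; rewrite linearZl_LR zq.
have [||c cP] := @monotone_linear_solve R I g
    (fun i j => beta * q i (z j)) (fun i => q i u0) (beta * Ccoerc / S) _ g_cont g_mono.
- by rewrite divr_gt0// mulr_gt0.
- move=> x; pose Z := \sum_i x i *: z i.
  have -> : \sum_i (\sum_j beta * q i (z j) * x j) * x i = beta * a Z Z.
    rewrite {1}/Z aZ mulr_sumr; apply: eq_bigr => i _.
    rewrite -[q i Z]zq /Z linear_sumr !mulr_sumr mulr_suml.
    by apply: eq_bigr => j _; rewrite (linearZr_LR a) zq; ring.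
  rewrite -!mulrA ler_pM2l//; apply: le_trans (a_coerc Z).
  rewrite ler_pM2l// mulrC ler_pdivrMr// /S mulrDr mulr1 -[leLHS]addr0 lerD//.
    rewrite mulr_sumr; apply: ler_sum => i _.
    rewrite -exprMn -(sum_dual x (wq i)) -aZ -/Z -[leLHS]real_normK ?num_real//.
    have aZw : `|a Z (w i)| <= N Z * (Ccont * N (w i)).
      by rewrite mulrCA mulrA a_normr.
    by rewrite lerXn2r ?nnegrE// (le_trans _ aZw).
  exact: sqr_ge0.
(* This [u] solves the first equation for any [c]. The second one reduces to the system solved by
   [c], because symmetry of [a] gives [q i (z j) = q j (z i)]. *)
exists (u0 - beta *: \sum_i c i *: z i), c; split => [v|i].
  by rewrite linearBl linearZl_LR aZ u0l subrK.
rewrite -zq linearBr linearZr_LR zq -(cP i) a_sym aZ mulr_sumr.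
rewrite -addrA -sumrB big1 ?addr0// => j _.
by rewrite -[q i (z j)]zq a_sym zq; ring.
Qed.

Lemma mixed_solution_unique u u' c c' :
  mixed_solution u c -> mixed_solution u' c' -> u = u' /\ c = c'.
Proof.
move=> [uc qu] [uc' qu'].
have E v : a (u - u') v + beta * \sum_i (c i - c' i) * q i v = 0.
  rewrite linearBl; under eq_bigr do rewrite mulrBl.
  by rewrite sumrB mulrBr; have := uc v; have := uc' v; lra.
have qB i v v' : q i (v - v') = q i v - q i v'.
  by rewrite [v - v']addrC -scaleN1r q_scalar; ring.
have /subr0_eq uu' : u - u' = 0.
  apply: a_eq0; have := E (u - u'); have := g_mono c c'.
  under eq_bigr do rewrite -qu -qu' -qB mulrC.
  by move=> /(mulr_ge0 (ltW beta_gt0)); lra.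
(* Once [u = u'], the first equations differ only by the multiplier term, and the dual vector of
   index [i] reads off its coordinate. *)
split => //; apply/funext => i; have [w /(sum_dual (fun i => c i - c' i))] := q_dual i.
have := E w; rewrite uu' subrr linear0l add0r => /eqP.
by rewrite mulf_eq0 gt_eqF//= => /eqP -> /esym /subr0_eq.
Qed.

End mixed_problem.

(** * Lebesgue measure on R^n *)

(** Balls of the sup norm are cubes, which reduces their measurability to single coordinates. *)
Lemma ball_rVE (R : realType) n (x : 'rV[R]_n) (r : R) : 0 < r ->
  ball x r = \bigcap_(i in [set: 'I_n]) (@rV_coord R n i @^-1` ball (x ord0 i) r).
Proof.
move=> r0; apply/seteqP; split => [y [_ xy] i _|y xy]; first exact: xy.
by split => // i j; rewrite ord1; exact: xy.
Qed.

Lemma measurable_ball_rV (R : realType) n (x : 'rV[R]_n) (r : R) : 0 < r ->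
  measurable (ball x r).
Proof.
move=> r0; rewrite ball_rVE//; apply: fin_bigcap_measurable => // i _.
rewrite -[X in measurable X]setTI; apply: measurable_rV_coord => //.
exact: measurable_ball.
Qed.

(** The sigma-algebra is generated by coordinates, so an open set is written as a countable union of
    cubes with rational centres and radii 1/(k+1); cubes not inside [U] are replaced by the empty
    set. *)
Lemma measurable_open_rV (R : realType) n (U : set 'rV[R]_n) :
  open U -> measurable U.
Proof.
move=> oU.
pose c (q : 'rV[rat]_n) : 'rV[R]_n := map_mx ratr q.
pose B (z : 'rV[rat]_n * nat) : set 'rV[R]_n := ball (c z.1) (z.2.+1%:R^-1).
have -> : U = \bigcup_z (if `[< B z `<=` U >] then B z else set0).
  apply/seteqP; split => [x Ux|x [z _]]; last by case: asboolP => // + Bx; exact.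
  have /nbhs_ballP[e /= e0 xeU] := open_nbhs_nbhs (conj oU Ux).
  (* The rational centre is within [r] of [x], so its cube of radius [r] stays within [2 r < e] of
     [x]. *)
  have [k _ /= ke] : exists2 k, True & (k.+1%:R^-1 : R) < e / 2.
    have e20 : 0 < e / 2 by rewrite divr_gt0.
    have [k _ kP] := near_infty_natSinv_lt (PosNum e20).
    by exists k => //; exact: (kP k (leqnn k)).
  set r : R := k.+1%:R^-1 in ke *.
  have r0 : 0 < r by rewrite invr_gt0.
  have /choice[q qP] : forall i, exists q : rat, `|x ord0 i - ratr q| < r.
    move=> i; have /rat_in_itvoo[q] : x ord0 i - r < x ord0 i + r by lra.
    by rewrite in_itv/= => /andP[q1 q2]; exists q; rewrite ltr_norml; lra.
  pose Q := (\row_i q i)%R.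
  have BU : B (Q, k) `<=` U.
    move=> y [_ /= yQ]; apply: xeU; split => // i j; rewrite ord1.
    have := yQ ord0 j; rewrite /c !mxE /ball/= => yq.
    rewrite -[_ - _](subrKA (ratr (q j))) (le_lt_trans (ler_normD _ _))//.
    have := qP j; rewrite -/r in yq; lra.
  exists (Q, k) => //; case: asboolP => // _; split => // i j.
  by rewrite /c !mxE ord1 /ball/= distrC; exact: qP.
apply: countable_bigcupT_measurable => // z; case: asboolP => // _.
by apply: measurable_ball_rV; rewrite invr_gt0.
Qed.

Lemma leb_ball (R : realType) n (x : 'rV[R]_n) (r : R) : 0 < r ->
  leb R n (ball x r) = ((r *+ 2) ^+ n)%:E.
Proof.
move=> r0; elim: n => [|n IH] in x *.
  rewrite /= diracE mem_set//; split => // i [] //.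
rewrite /= /leb_step /pushforward.
rewrite (_ : @consrV R n @^-1` ball x r =
   ball (x ord0 ord0) r `*` ball (rsubmx (x : 'rV[R]_(1 + n))) r).
  rewrite product_measure1E//; [|exact: measurable_ball|exact: measurable_ball_rV].
  by rewrite [X in (X * _)%E](lebesgue_measure_ball _ (ltW r0)) IH -EFinM exprS.
apply/seteqP; split => [[t y] [_ /= xy]|[t y] [/= xt [_ xy]]].
  split => /=.
    by have := xy ord0 ord0; rewrite -[t in X in _ -> X](congr1 fst (consrVK (t, y))).
  split => // i j; have := xy i (rshift 1 j).
  by rewrite /consrV (@row_mxEr _ 1 1 n) !mxE.
split => // i j; rewrite ord1; case: (@split_ordP 1 n j) => k ->.
  rewrite /consrV (@row_mxEl _ 1 1 n) !mxE (ord1 k).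
  by rewrite (_ : lshift n ord0 = ord0)//; exact/val_inj.
by have := xy ord0 k; rewrite /consrV (@row_mxEr _ 1 1 n) !mxE.
Qed.

Lemma leb_open_gt0 (R : realType) n (U : set 'rV[R]_n) :
  open U -> U !=set0 -> (0 < leb R n U)%E.
Proof.
move=> oU [x Ux]; have /nbhs_ballP[r /= r0 xrU] := open_nbhs_nbhs (conj oU Ux).
apply: (@lt_le_trans _ _ (leb R n (ball x r))).
  by rewrite leb_ball// lte_fin exprn_gt0// mulrn_wgt0.
by apply: le_measure => //; rewrite inE; [exact: measurable_ball_rV|exact: measurable_open_rV].
Qed.

Lemma leb_bounded_lty (R : realType) n (D : set 'rV[R]_n) :
  measurable D -> bounded_set D -> (leb R n D < +oo)%E.
Proof.
move=> mD [M [_ DM]].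
(* [bounded_set] bounds the norm by every number above [M], such as [|M| + 1]; one more unit fits
   [D] into an open ball. *)
have M0 : 0 < `|M| + 2 by rewrite ltr_wpDl.
apply: (@le_lt_trans _ _ (leb R n (ball 0 (`|M| + 2)))); last first.
  by rewrite leb_ball// ltry.
apply: le_measure; rewrite ?inE//; first exact: measurable_ball_rV.
move=> x Dx; rewrite -ball_normE/= sub0r normrN.
apply: (@le_lt_trans _ _ (`|M| + 1)); last by rewrite ltrD2l ltr1n.
by apply: DM => //; rewrite (le_lt_trans (ler_norm M))// ltrDl.
Qed.

(** * The L^2 inner product *)

(** [Lp] is phrased through extension by zero; the same form of [ip] gives access to results on
    functions over the whole space. *)
Lemma ip_mkcond (R : realType) n (D : set 'rV[R]_n) (u v : 'rV[R]_n -> R) :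
  ip D u v = \int[leb R n]_x ((u \_ D) x * (v \_ D) x).
Proof.
rewrite /ip Rintegral_mkcond; congr Rintegral; apply/funext => x.
by rewrite /patch; case: ifPn => //; rewrite mul0r.
Qed.

Lemma ipC (R : realType) n (D : set 'rV[R]_n) (u v : 'rV[R]_n -> R) :
  ip D u v = ip D v u.
Proof. by congr Rintegral; apply/funext => x; rewrite mulrC. Qed.

Lemma integrable_ip (R : realType) n (D : set 'rV[R]_n) (u v : 'rV[R]_n -> R) :
  Lp D 2%:E u -> Lp D 2%:E v ->
  (leb R n).-integrable setT (EFin \o ((u \_ D) \* (v \_ D))).
Proof. by move=> Du Dv; apply/Lfun1_integrable; exact: Lfun2_mul_Lfun1. Qed.

Lemma ipPl (R : realType) n (D : set 'rV[R]_n) (c : R) (u v w : 'rV[R]_n -> R) :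
  Lp D 2%:E u -> Lp D 2%:E v -> Lp D 2%:E w ->
  ip D (fun x => c * u x + v x) w = c * ip D u w + ip D v w.
Proof.
move=> Du Dv Dw; rewrite !ip_mkcond.
have iu := integrable_ip Du Dw; have iv := integrable_ip Dv Dw.
rewrite -RintegralZl// -RintegralD//; last first.
  rewrite (_ : _ \o _ = (fun x => c%:E * ((u \_ D) x * (w \_ D) x)%R%:E)%E)//.
  exact: integrableZl.
congr Rintegral; apply/funext => x; rewrite /patch.
by case: ifPn => _; rewrite ?mul0r ?mulr0 ?addr0//; ring.
Qed.

Lemma LpP (R : realType) n (D : set 'rV[R]_n) (c : R) (p : \bar R)
    (u v : 'rV[R]_n -> R) :
  (1 <= p)%E -> Lp D p u -> Lp D p v -> Lp D p (fun x => c * u x + v x).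
Proof.
move=> p1 Du Dv; rewrite /Lp.
have [_ /(_ c _ _ Du Dv)] := Lfun_submod_closed (leb R n) p1.
rewrite (_ : (c *: _ + _)%R = (fun x => c * u x + v x) \_ D)//.
apply/funext => x; rewrite -[LHS]/(c * (u \_ D) x + (v \_ D) x) /patch.
by case: ifPn => // _; rewrite mulr0 addr0.
Qed.

Lemma Lp_sum (R : realType) n (D : set 'rV[R]_n) (p : \bar R) (I : Type)
    (r : seq I) (c : I -> R) (g : I -> 'rV[R]_n -> R) :
  (1 <= p)%E -> (forall i, Lp D p (g i)) ->
  Lp D p (fun x => \sum_(i <- r) c i * g i x).
Proof.
move=> p1 Dg; elim: r => [|i r IH].
  have [+ _] := Lfun_submod_closed (leb R n) p1; rewrite /Lp.
  rewrite (_ : patch _ _ _ = cst 0)//; apply/funext => x.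
  by rewrite /patch big_nil if_same.
have -> : (fun x => \sum_(j <- i :: r) c j * g j x)
    = (fun x => c i * g i x + \sum_(j <- r) c j * g j x).
  by apply/funext => x; rewrite big_cons.
exact: LpP.
Qed.

Lemma ip_suml (R : realType) n (D : set 'rV[R]_n) (I : Type)
    (r : seq I) (c : I -> R) (g : I -> 'rV[R]_n -> R) (w : 'rV[R]_n -> R) :
  (forall i, Lp D 2%:E (g i)) -> Lp D 2%:E w ->
  ip D (fun x => \sum_(i <- r) c i * g i x) w = \sum_(i <- r) c i * ip D (g i) w.
Proof.
move=> Dg Dw; elim: r => [|i r IH].
  rewrite big_nil /ip; under eq_Rintegral do rewrite big_nil mul0r.
  by rewrite /Rintegral integral0.
rewrite big_cons -IH -ipPl//; last by apply: Lp_sum => //; rewrite lee1n.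
by congr (ip D _ w); apply/funext => x; rewrite big_cons.
Qed.

(** Cauchy-Schwarz, as Hoelder with both exponents 2. It passes from continuity into L^2 to
    continuity of element moments. *)
Lemma ip_hoelder (R : realType) n (D : set 'rV[R]_n) (u v : 'rV[R]_n -> R) :
  Lp D 2%:E u -> Lp D 2%:E v ->
  (`|ip D u v|%:E <= Lp_norm D 2%:E u * Lp_norm D 2%:E v)%E.
Proof.
move=> Du Dv; have uv := integrable_ip Du Dv.
rewrite ip_mkcond EFin_normr_Rintegral//.
have [mu mv] : measurable_fun setT (u \_ D) /\ measurable_fun setT (v \_ D).
  by move: Du Dv; rewrite /Lp !inE => /andP[/[!inE]/= ? _] /andP[/[!inE]/= ? _].
apply: (le_trans _ (hoelder _ mu mv _ _ _)) => //; last by rewrite [RHS]splitr !div1r.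
rewrite Lnorm1; apply: le_abse_integral => //.
exact: (measurable_int _ uv).
Qed.

Lemma Lp2_bounded (R : realType) n (D : set 'rV[R]_n) (v : 'rV[R]_n -> R) (M : R) :
  measurable D -> (leb R n D < +oo)%E -> measurable_fun setT v ->
  (forall x, D x -> `|v x| <= M) -> Lp D 2%:E v.
Proof.
move=> mD Dfin mv vM; have mvD : measurable_fun setT (v \_ D).
  by apply/(measurable_restrictT _ mD); exact: measurable_funS mv.
rewrite /Lp inE; apply/andP; split; rewrite inE//=.
rewrite /finite_norm unlock poweR_lty//.
apply: (@le_lt_trans _ _ (\int[leb R n]_(x in D) (M `^ 2)%:E)%E); last first.
  by rewrite integral_cst// lte_mul_pinfty// lee_fin powR_ge0.
rewrite [leRHS]integral_mkcond; apply: ge0_le_integral => //.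
- by move=> x _; rewrite poweR_ge0.
- apply: (measurableT_comp (measurable_poweR _)).
  by apply: measurableT_comp => //; exact/measurable_EFinP.
- by apply/(measurable_restrictT _ mD).
move=> x _; rewrite /patch/=; case: ifPn => [|_]; last by rewrite normr0 powR0.
rewrite inE => Dx; rewrite lee_fin ge0_ler_powR// ?nnegrE//.
  exact: le_trans (vM x Dx).
exact: vM.
Qed.

Lemma Lpoo_norm_le (R : realType) n (D : set 'rV[R]_n) (v : 'rV[R]_n -> R) (M : R) :
  0 <= M -> (forall x, `|v x| <= M) -> (Lp_norm D +oo%E v <= M%:E)%E.
Proof.
(* The L^oo norm is an essential supremum only over a space of positive measure and 0 otherwise;
   [M0] settles the second case. *)
move=> M0 vM; rewrite /Lp_norm unlock; case: ifPn => _; last by rewrite lee_fin.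
apply/ess_supP/nearW => x /=; rewrite lee_fin /patch.
by case: ifPn => // _; rewrite normr0.
Qed.

Lemma Lpoo_bounded (R : realType) n (D : set 'rV[R]_n) (v : 'rV[R]_n -> R) (M : R) :
  measurable D -> measurable_fun setT v -> 0 <= M ->
  (forall x, `|v x| <= M) -> Lp D +oo%E v.
Proof.
move=> mD mv M0 vM; rewrite /Lp inE; apply/andP; split; rewrite inE/=.
  by apply/(measurable_restrictT _ mD); exact: measurable_funS mv.
by apply: (le_lt_trans (Lpoo_norm_le D M0 vM)); rewrite ltry.
Qed.

Lemma LpB (R : realType) n (D : set 'rV[R]_n) (p : \bar R) (u v : 'rV[R]_n -> R) :
  (1 <= p)%E -> Lp D p u -> Lp D p v -> Lp D p (u \- v).
Proof.
move=> p1 Du Dv; have -> : u \- v = fun x => -1 * v x + u x.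
  by apply/funext => x /=; ring.
exact: LpP.
Qed.

Lemma ipBl (R : realType) n (D : set 'rV[R]_n) (u v w : 'rV[R]_n -> R) :
  Lp D 2%:E u -> Lp D 2%:E v -> Lp D 2%:E w ->
  ip D (u \- v) w = ip D u w - ip D v w.
Proof.
move=> Du Dv Dw; have -> : u \- v = fun x => -1 * v x + u x.
  by apply/funext => x /=; ring.
by rewrite ipPl//; ring.
Qed.

Lemma ipZl (R : realType) n (D : set 'rV[R]_n) (c : R) (u w : 'rV[R]_n -> R) :
  Lp D 2%:E u -> Lp D 2%:E w -> ip D (fun x => c * u x) w = c * ip D u w.
Proof.
move=> Du Dw; have -> : (fun x => c * u x) = fun x => (c - 1) * u x + u x.
  by apply/funext => x; ring.
by rewrite ipPl//; ring.
Qed.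

Lemma ip_eq0 (R : realType) n (D : set 'rV[R]_n) (u v : 'rV[R]_n -> R) :
  (forall x, u x * v x = 0) -> ip D u v = 0.
Proof.
move=> uv0; rewrite /ip (_ : (fun x => _) = cst 0); last exact/funext.
by rewrite /Rintegral integral0.
Qed.

(** * Piecewise polynomials *)

Section mesh.
Context (R : realType) (m : nat).
Local Notation E := 'rV[R]_m.+1.
Context (Th : finType) (X : Th -> 'M[R]_(m.+2, m.+1)).

(** Barycentric coordinate of [x] at vertex [lift ord0 j]; the one at vertex 0 is 1 minus the sum of
    these. *)
Definition bary (K : Th) (x : E) (j : 'I_m.+1) : R :=
  ((x - row ord0 (X K)) *m invmx (edges (X K))) ord0 j.

(** Eliminating the weight of vertex 0 leaves an affine map inverted by the edge matrix. The element
    thus becomes a set of strict inequalities between continuous functions, hence open. *)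
Lemma elt_baryE (K : Th) : \det (edges (X K)) != 0 ->
  elt X K = [set x | (forall j, 0 < bary K x j) /\ \sum_j bary K x j < 1].
Proof.
move=> dX; have uX : edges (X K) \in unitmx by rewrite unitmxE unitfE.
have mulE (l : 'rV[R]_m.+2) : \sum_i l ord0 i = 1 ->
    l *m X K - row ord0 (X K) = (\row_j l ord0 (lift ord0 j)) *m edges (X K).
  move=> l1; apply/rowP => c; rewrite !mxE big_ord_recl /=.
  have -> : l ord0 ord0 = 1 - \sum_j l ord0 (lift ord0 j).
    by rewrite -l1 big_ord_recl addrK.
  under [RHS]eq_bigr do rewrite !mxE mulrBr.
  by rewrite sumrB -mulr_suml; ring.
apply/seteqP; split => [x [l [l0 l1 ->]]|x [t0 t1]] /=.
  have tE j : bary K (l *m X K) j = l ord0 (lift ord0 j).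
    by rewrite /bary mulE// mulmxK// mxE.
  under eq_bigr do rewrite tE.
  split => [j|]; first by rewrite tE.
  by rewrite -l1 [ltRHS]big_ord_recl ltrDr.
pose l : 'rV[R]_m.+2 :=
  \row_i oapp (bary K x) (1 - \sum_j bary K x j) (unlift ord0 i).
have l0 : l ord0 ord0 = 1 - \sum_j bary K x j by rewrite mxE unlift_none.
have lS j : l ord0 (lift ord0 j) = bary K x j by rewrite mxE liftK.
have l1 : \sum_i l ord0 i = 1.
  by rewrite big_ord_recl l0; under [X in _ + X]eq_bigr do rewrite lS; rewrite subrK.
exists l; split => // [i|].
  by have [j ->|->] := unliftP ord0 i; rewrite (lS, l0)// subr_gt0.
apply/esym/(addIr (- row ord0 (X K))); rewrite mulE//.
rewrite (_ : \row_j _ = (x - row ord0 (X K)) *m invmx (edges (X K))).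
  by rewrite mulmxKV.
by apply/rowP => j; rewrite mxE lS.
Qed.

Lemma bary_continuous (K : Th) (j : 'I_m.+1) : continuous (bary K ^~ j).
Proof.
have -> : bary K ^~ j = fun x => \sum_i (x ord0 i - X K ord0 i) *
    invmx (edges (X K)) i j.
  by apply/funext => x; rewrite /bary mxE; apply: eq_bigr => i _; rewrite !mxE.
apply: continuous_big => [|i _ x]; first exact: (@add_continuous (R : normedModType R)).
apply: (@continuousM _ _ (fun y : E => y ord0 i - X K ord0 i)); last exact: cst_continuous.
apply: continuousB; last exact: cst_continuous.
exact: coord_continuous.
Qed.

Lemma open_elt (K : Th) : \det (edges (X K)) != 0 -> open (elt X K).
Proof.
move=> dX; rewrite elt_baryE// openE => x [t0 t1] /=.
apply: filterI.
  apply: (filter_forall (nbhs_filter x)) => j.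
  by apply: cvgr_gt (t0 j); exact: bary_continuous.
have cS : continuous (fun y => \sum_j bary K y j).
  apply: continuous_big => [|j _].
    exact: (@add_continuous (R : normedModType R)).
  exact: bary_continuous.
exact: cvgr_lt (cS x) _ t1.
Qed.

Lemma elt_nonempty (K : Th) : elt X K !=set0.
Proof.
exists ((const_mx m.+2%:R^-1 : 'rV[R]_m.+2) *m X K), (const_mx m.+2%:R^-1); split => //.
  by move=> i; rewrite mxE invr_gt0.
under eq_bigr do rewrite mxE.
by rewrite sumr_const card_ord -[LHS]mulr_natr mulVf.
Qed.

Lemma elt_hull (K : Th) : elt X K `<=` hull (X K).
Proof.
move=> x [l [l0 l1 ->]]; exists l; split => // i.
  exact: ltW.
by rewrite inE.
Qed.

Lemma poly_funE0 (c : {ffun 'I_m.+1 -> 'I_1} -> R) (x : E) :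
  @poly_fun R m 0 c x = c [ffun=> ord0].
Proof.
rewrite /poly_fun (big_pred1 [ffun=> ord0]) => [|d].
  by rewrite big1 ?mulr1// => i _; rewrite ffunE expr0.
have -> : d = [ffun=> ord0] by apply/ffunP => i; rewrite ffunE ord1.
by rewrite /= eqxx big1// => i _; rewrite ffunE.
Qed.

(** Coordinates on W_h; the value 0 off the open elements agrees with the representatives chosen in
    [broken_poly]. *)
Definition step (c : Th -> R) (x : E) : R := \sum_K c K * \1_(elt X K) x.

Section disjoint_elements.
Hypothesis dX : forall K, \det (edges (X K)) != 0.
Hypothesis Xdisj : forall K K', K != K' -> elt X K `&` elt X K' = set0.

Lemma indic_elt K L x : elt X K x -> \1_(elt X L) x = (L == K)%:R :> R.
Proof.
move=> Kx; rewrite indicE; have [->|LK] := eqVneq L K; first by rewrite mem_set.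
rewrite memNset// => Lx; have : (elt X L `&` elt X K) x by [].
by rewrite Xdisj.
Qed.

(** At most one indicator is nonzero at each point. The finite sum carries measurability and bounds
    over from the single pieces. *)
Lemma broken_polyE v (q : Th -> E -> R) :
  (forall K x, elt X K x -> v x = q K x) ->
  (forall x, (forall K, ~ elt X K x) -> v x = 0) ->
  v = fun x => \sum_K \1_(elt X K) x * q K x.
Proof.
move=> vq v0; apply/funext => x; have [[K Kx]|xN] := pselect (exists K, elt X K x).
  rewrite (bigD1 K)//= (indic_elt K Kx) eqxx mul1r (vq K)// big1 ?addr0// => L LK.
  by rewrite (indic_elt L Kx) (negPf LK) mul0r.
rewrite v0 => [|K Kx]; last by apply: xN; exists K.
by rewrite big1// => K _; rewrite indicE memNset ?mul0r// => Kx; apply: xN; exists K.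
Qed.

Lemma broken_poly0P v : broken_poly X 0 v <-> exists c, v = step c.
Proof.
split => [[vX v0]|[c ->]].
  have /choice[c cP] : forall K, exists c : R, forall x, elt X K x -> v x = c.
    move=> K; have [d dP] := vX K; exists (d [ffun=> ord0]) => x Kx.
    by rewrite dP// poly_funE0.
  exists c; rewrite (broken_polyE (q := fun K _ => c K) cP v0).
  by apply/funext => x; apply: eq_bigr => K _; rewrite mulrC.
split => [K|x xN]; last first.
  by rewrite /step big1// => K _; rewrite indicE memNset ?mulr0//; exact: xN.
exists (fun=> c K) => x Kx; rewrite poly_funE0 /step (bigD1 K)//=.
rewrite (indic_elt K Kx) eqxx mulr1 big1 ?addr0// => L LK.
by rewrite (indic_elt L Kx) (negPf LK) mulr0.
Qed.

Lemma measurable_elt K : measurable (elt X K).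
Proof. by apply: measurable_open_rV; exact: open_elt. Qed.

Lemma measurable_poly_fun p (c : {ffun 'I_m.+1 -> 'I_p.+1} -> R) :
  measurable_fun setT (poly_fun c).
Proof.
have -> : poly_fun c = fun x => \sum_(a : {ffun 'I_m.+1 -> 'I_p.+1})
    if (\sum_i a i <= p)%N then c a * \prod_i x ord0 i ^+ a i else 0.
  by apply/funext => x; rewrite /poly_fun big_mkcond.
apply: measurable_sum => a; case: (_ <= p)%N; last exact: measurable_cst.
apply: measurable_funM; first exact: measurable_cst.
apply: measurable_prod => i _; apply: measurable_funX.
exact: measurable_rV_coord.
Qed.

Lemma bounded_poly_fun p (c : {ffun 'I_m.+1 -> 'I_p.+1} -> R) (D : set E) :
  bounded_set D -> exists M, forall x, D x -> `|poly_fun c x| <= M.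
Proof.
move=> [B [_ DB]]; pose B1 := `|B| + 1.
exists (\sum_(a : {ffun 'I_m.+1 -> 'I_p.+1}) `|c a| * \prod_i B1 ^+ a i) => x Dx.
have xB i : `|x ord0 i| <= B1.
  apply: le_trans (DB B1 _ x Dx); last by rewrite (le_lt_trans (ler_norm B))// ltrDl.
  by rewrite [leRHS]/Num.norm/= mx_normrE; exact: (le_bigmax _ _ (ord0, i)).
rewrite /poly_fun big_mkcond/=; apply: (le_trans (ler_norm_sum _ _ _)).
apply: ler_sum => a _; case: ifPn => _; last first.
  by rewrite normr0 mulr_ge0// prodr_ge0// => i _; rewrite exprn_ge0// addr_ge0.
rewrite normrM ler_wpM2l// normr_prod; apply: ler_prod => i _.
by rewrite normr_ge0 normrX/= lerXn2r// nnegrE addr_ge0.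
Qed.

Lemma measurable_broken_poly (p : nat) v : broken_poly X p v -> measurable_fun setT v.
Proof.
move=> [/choice[c cP] v0]; rewrite (broken_polyE (q := fun K => poly_fun (c K)) cP v0).
apply: measurable_sum => K; apply: measurable_funM.
  by apply: measurable_indic; exact: measurable_elt.
exact: measurable_poly_fun.
Qed.

Lemma bounded_broken_poly (p : nat) v (D : set E) : broken_poly X p v ->
  bounded_set D -> exists M, forall x, D x -> `|v x| <= M.
Proof.
move=> [/choice[c cP] v0] bD.
have /choice[M MP] : forall K, exists M, forall x, D x -> `|poly_fun (c K) x| <= M.
  by move=> K; exact: bounded_poly_fun.
exists (\sum_K `|M K|) => x Dx.
rewrite (broken_polyE (q := fun K => poly_fun (c K)) cP v0).
apply: (le_trans (ler_norm_sum _ _ _)); apply: ler_sum => K _.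
rewrite normrM indicE -[leRHS]mul1r ler_pM//.
  by case: (x \in _); rewrite ?normr1 ?normr0.
exact: le_trans (MP K x Dx) (ler_norm _).
Qed.

Lemma Lp2_broken_poly (p : nat) v (D : set E) : open D -> bounded_set D ->
  broken_poly X p v -> Lp D 2%:E v.
Proof.
move=> oD bD vX; have [M vM] := bounded_broken_poly vX bD.
have mD := measurable_open_rV oD.
apply: (Lp2_bounded mD _ _ vM); first exact: leb_bounded_lty.
exact: measurable_broken_poly vX.
Qed.

Lemma step_le c x M : 0 <= M -> (forall K, `|c K| <= M) -> `|step c x| <= M.
Proof.
move=> M0 cM; have [[K Kx]|xN] := pselect (exists K, elt X K x).
  rewrite /step (bigD1 K)//= (indic_elt K Kx) eqxx mulr1 big1 ?addr0// => L LK.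
  by rewrite (indic_elt L Kx) (negPf LK) mulr0.
rewrite /step big1 ?normr0// => K _.
by rewrite indicE memNset ?mulr0// => Kx; apply: xN; exists K.
Qed.

Lemma Lpoo_step c (D : set E) : measurable D -> Lp D +oo%E (step c).
Proof.
move=> mD; apply: (@Lpoo_bounded _ _ _ _ (\sum_K `|c K|)) => //.
- by apply: (@measurable_broken_poly 0); apply/broken_poly0P; exists c.
- by rewrite sumr_ge0.
move=> x; apply: step_le => [|K]; first by rewrite sumr_ge0.
by rewrite (bigD1 K)//= lerDl sumr_ge0.
Qed.

End disjoint_elements.

End mesh.

Lemma ip_indic (R : realType) n (D A : set 'rV[R]_n) :
  measurable D -> measurable A -> ip D \1_A \1_A = fine (leb R n (A `&` D)).
Proof.
move=> mD mA; rewrite /ip /Rintegral -integral_indic//; congr fine.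
apply: eq_integral => x _; congr EFin; rewrite indicE.
by case: (x \in A); rewrite ?mulr1 ?mulr0.
Qed.

(** The mesh only places the element in the closure of [Omega], but an open set meeting the closure
    meets [Omega] in a nonempty open set. Finiteness of the measure matters because [fine] sends
    infinity to 0. *)
Lemma elt_mass_gt0 (R : realType) (m : nat) (Th : finType)
    (X : Th -> 'M[R]_(m.+2, m.+1)) (Omega : set 'rV[R]_m.+1) (sigma : R) (K : Th) :
  simplicial_mesh X Omega sigma -> open Omega -> bounded_set Omega ->
  0 < ip Omega \1_(elt X K) \1_(elt X K).
Proof.
move=> [dX clX _ _ _] oO bO; have oK : open (elt X K) by exact: open_elt.
have mK := measurable_open_rV oK; have mO := measurable_open_rV oO.
rewrite ip_indic// fine_gt0// leb_open_gt0/=; last 2 first.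
- exact: openI.
- have [x Kx] := elt_nonempty X K.
  have : closure Omega x by rewrite clX; exists K => //; exact: elt_hull.
  move=> /(_ _ (open_nbhs_nbhs (conj oK Kx)))[y [Oy Ky]].
  by exists y.
apply: (le_lt_trans _ (leb_bounded_lty mO bO)); apply: le_measure => //.
- by rewrite inE; exact: measurableI.
- by rewrite inE.
Qed.

Lemma step_indic (R : realType) (m : nat) (Th : finType)
    (X : Th -> 'M[R]_(m.+2, m.+1)) (K : Th) :
  step X (fun L => (L == K)%:R) = \1_(elt X K).
Proof.
apply/funext => x; rewrite /step (bigD1 K)//= eqxx mul1r big1 ?addr0// => L LK.
by rewrite (negPf LK) mul0r.
Qed.

Lemma stepB (R : realType) (m : nat) (Th : finType)
    (X : Th -> 'M[R]_(m.+2, m.+1)) (c d : Th -> R) :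
  step X c \- step X d = step X (fun K => c K - d K).
Proof.
by apply/funext => x; rewrite /= /step -sumrB; apply: eq_bigr => K _; rewrite mulrBl.
Qed.

(** * Existence and uniqueness for one discrete proximal step *)

Theorem theorem5p3 (R : realType) (m : nat)
  (dim23 : m.+1 = 2%N \/ m.+1 = 3%N)
  (Omega : set 'rV[R]_m.+1) (Omega_dom : lipschitz_domain Omega)
  (f : 'rV[R]_m.+1 -> R) (f_L2 : Lp Omega 2%:E f)
  (phi : 'rV[R]_m.+1 -> R) (phi_H1 : H1 Omega phi)
  (phi_C0 : {within closure Omega, continuous phi})
  (phi_bd : forall x, (closure Omega `\` Omega) x -> phi x <= 0)
  (Rf : 'rV[R]_m.+1 -> R -> \bar R)
  (Rf_car : caratheodory Omega Rf)
  (Rf_leg : legendre_integrand Omega phi Rf)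
  (grad_range : grad_conj_range Omega phi Rf)
  (grad_cont : grad_conj_continuous Omega Rf)
  (grad_mono : grad_conj_strictly_monotone Omega Rf)
  (Th : finType) (X : Th -> 'M[R]_(m.+2, m.+1)) (sigma : R)
  (mesh : simplicial_mesh X Omega sigma)
  (Vh : vectType R) (normV : Vh -> R) (normV_norm : is_norm normV)
  (VT : set ('rV[R]_m.+1 -> R))
  (VT_lin : forall (a : R) u v, VT u -> VT v -> VT (fun x => a * u x + v x))
  (VT_P0 : forall w, broken_poly X 0 w -> VT w)
  (VT_P1 : forall v, VT v -> broken_poly X 1 v)
  (p : {linear Vh -> ('rV[R]_m.+1 -> R^o)})
  (p_VT : forall v, VT (p v))
  (p_onto : forall w, broken_poly X 0 w -> exists v, p v = w)
  (a : {biscalar Vh}) (a_sym : forall u v, a u v = a v u)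
  (Ccoerc Ccont Cp CPi : R)
  (Ccoerc_gt0 : 0 < Ccoerc) (Ccont_gt0 : 0 < Ccont)
  (Cp_gt0 : 0 < Cp) (CPi_gt0 : 0 < CPi)
  (a_coerc : forall v, Ccoerc * normV v ^+ 2 <= a v v)
  (a_cont : forall v z, a v z <= Ccont * normV v * normV z)
  (p_bound : forall v, DG_norm X (p v) <= Cp * normV v)
  (Pi : ('rV[R]_m.+1 -> R) -> Vh)
  (Pi_lin : forall (c : R) u v, broken_H1 X Omega u -> broken_H1 X Omega v ->
     Pi (fun x => c * u x + v x) = c *: Pi u + Pi v)
  (Pi_orth : forall v, broken_H1 X Omega v -> forall w, broken_poly X 0 w ->
     ip Omega (fun x => p (Pi v) x - v x) w = 0)
  (Pi_bound : forall v, broken_H1 X Omega v ->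
     normV (Pi v) <= CPi * DG_norm X v)
  (k : nat) (k_ge1 : (1 <= k)%N)
  (psi_prev : 'rV[R]_m.+1 -> R) (psi_prev_W : broken_poly X 0 psi_prev)
  (alpha : R) (alpha_gt0 : 0 < alpha) :
  exists! sol : Vh * ('rV[R]_m.+1 -> R),
    let u := sol.1 in
    let psi := sol.2 in
    let lambda := fun x => (psi_prev x - psi x) / alpha in
    [/\ broken_poly X 0 psi,
        forall v : Vh, a u v - ip Omega (p v) lambda = ip Omega f (p v) &
        forall w, broken_poly X 0 w ->
          ip Omega (p u) w
          - ip Omega (grad_conj Rf (fun x => psi_prev x - alpha * lambda x)) w
          = 0].
Proof.
have [oO _ _ bO _] := Omega_dom; have [dX _ Xdisj _ _] := mesh.
have mO := measurable_open_rV oO.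
have le12 : (1 <= 2%:E :> \bar R)%E by rewrite lee1n.
have W_L2 w : broken_poly X 0 w -> Lp Omega 2%:E w by exact: Lp2_broken_poly.
have p_L2 v : Lp Omega 2%:E (p v) by exact/(Lp2_broken_poly dX Xdisj oO bO)/VT_P1/p_VT.
have step_W c : broken_poly X 0 (step X c) by apply/(broken_poly0P Xdisj); exists c.
have chi_W K : broken_poly X 0 \1_(elt X K) by rewrite -step_indic.
have chi_L2 K : Lp Omega 2%:E \1_(elt X K) by exact: W_L2.
have step_oo c : Lp Omega +oo%E (step X c) by exact: Lpoo_step.
have grad_L2 c : Lp Omega 2%:E (grad_conj Rf (step X c)).
  by have [[]] := grad_range _ (step_oo c).
have mass_gt0 K := elt_mass_gt0 K mesh oO bO.
have ip_step v c : Lp Omega 2%:E v ->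
    ip Omega v (step X c) = \sum_K c K * ip Omega v \1_(elt X K).
  move=> v2; rewrite ipC ip_suml//; apply: eq_bigr => K _; by rewrite ipC.
pose q K v := ip Omega (p v) \1_(elt X K).
(* The known part [psi_prev / alpha] of lambda moves to the right-hand side; the unknown part stays
   as the multiplier term. *)
pose l v := ip Omega f (p v) + alpha^-1 * ip Omega (p v) psi_prev.
pose g c K := ip Omega (grad_conj Rf (step X c)) \1_(elt X K).
have ip_p w c u v : Lp Omega 2%:E w -> ip Omega (p (c *: u + v)) w
    = c * ip Omega (p u) w + ip Omega (p v) w.
  move=> w2; rewrite linearP -[c *: p u + p v]/(fun x => c * p u x + p v x).
  exact: ipPl.
have q_scalar K : scalar (q K) by move=> c u v; exact: ip_p.
have l_scalar : scalar l.
  move=> c u v; rewrite /l !(ipC _ f) !ip_p//; last exact: W_L2 psi_prev_W.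
  by rewrite !mulrDr addrACA (mulrCA alpha^-1).
(* The indicator of [K] divided by its mass lies in W_h, so [p] attains it; disjointness of the
   elements makes its other moments vanish. *)
have q_dual K : exists v, forall L, q L v = (L == K)%:R.
  pose t := (ip Omega \1_(elt X K) \1_(elt X K))^-1.
  have [v vP] := p_onto _ (step_W (fun L => t * (L == K)%:R)).
  exists v => L; rewrite /q vP ipC ip_step// (bigD1 K)//= eqxx mulr1 big1 ?addr0; last first.
    by move=> K' K'K; rewrite (negPf K'K) mulr0 mul0r.
  have [->|LK] := eqVneq L K; first by rewrite mulVf// gt_eqF.
  rewrite [ip _ _ _](_ : _ = 0) ?mulr0//.
  apply: ip_eq0 => x; have [Kx|Kx] := pselect (elt X K x).
    by rewrite (indic_elt Xdisj L Kx) (negPf LK) mul0r.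
  by rewrite mulrC indicE memNset// mul0r.
have g_mono x y : 0 <= \sum_K (g x K - g y K) * (x K - y K).
  have [+ _] := grad_mono _ _ (step_oo x) (step_oo y).
  rewrite stepB ip_step; last exact: LpB.
  by under eq_bigr do rewrite ipBl// mulrC.
have g_cont : coordwise_continuous g.
  (* Coefficients within [d] give step functions within [d] in L^oo, hence gradients within [e / T]
     in L^2. By Cauchy-Schwarz the moments are within [e], as [T] exceeds the L^2 norm of each
     indicator. *)
  move=> c e e0; pose T := \sum_K fine (Lp_norm Omega 2%:E \1_(elt X K)) + 1.
  have N0 K : (0 <= Lp_norm Omega 2%:E \1_(elt X K))%E by exact: Lnorm_ge0.
  have T0 : 0 < T by rewrite ltr_wpDl// sumr_ge0// => K _; rewrite fine_ge0.
  have eT : 0 < e / T by rewrite divr_gt0.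
  have [d d0 dP] := grad_cont _ (step_oo c) _ eT; exists d => // c' cc' K.
  rewrite /g -ipBl// -lee_fin; apply: (le_trans (ip_hoelder _ _)) => //.
    exact: LpB.
  apply: (@le_trans _ _ ((e / T)%:E * Lp_norm Omega 2%:E \1_(elt X K))%E).
    apply: lee_wpmul2r => //; apply: dP => //; rewrite stepB.
    by apply: Lpoo_norm_le => [|x]; [exact: ltW|apply: step_le => //; exact: ltW].
  have NK : Lp_norm Omega 2%:E \1_(elt X K) \is a fin_num.
    rewrite ge0_fin_numE//.
    by move: (chi_L2 K); rewrite /Lp inE => /andP[_]; rewrite inE.
  rewrite -(fineK NK) -EFinM lee_fin mulrAC ler_pdivrMr// ler_pM2l//.
  by rewrite /T (bigD1 K)//= -addrA lerDl addr_ge0// sumr_ge0// => K' _; rewrite fine_ge0.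
have alphaV_gt0 : 0 < alpha^-1 by rewrite invr_gt0.
(* In the argument of the gradient alpha cancels and leaves psi. By linearity, testing against W_h
   amounts to testing against the indicators. *)
have equiv u c : [/\ broken_poly X 0 (step X c),
    forall v : Vh, a u v - ip Omega (p v) (fun x => (psi_prev x - step X c x) / alpha)
      = ip Omega f (p v) &
    forall w, broken_poly X 0 w -> ip Omega (p u) w
      - ip Omega (grad_conj Rf (fun x => psi_prev x
          - alpha * ((psi_prev x - step X c x) / alpha))) w = 0]
    <-> mixed_solution a q l g alpha^-1 u c.
  have -> : (fun x => psi_prev x - alpha * ((psi_prev x - step X c x) / alpha))
      = step X c.
    by apply/funext => x; field; rewrite gt_eqF.
  have lamE v : ip Omega (p v) (fun x => (psi_prev x - step X c x) / alpha)
      = alpha^-1 * ip Omega (p v) psi_prev - alpha^-1 * \sum_K c K * q K v.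
    have -> : (fun x => (psi_prev x - step X c x) / alpha)
        = fun x => alpha^-1 * (psi_prev \- step X c) x.
      by apply/funext => x; rewrite mulrC.
    rewrite ipC ipZl//; last by apply: LpB => //; exact: W_L2.
    rewrite ipBl//; [|exact: W_L2 psi_prev_W|exact: W_L2 (step_W c)].
    rewrite mulrBr [ip _ psi_prev _]ipC [ip _ (step X c) _]ipC; congr (_ - _ * _).
    exact: ip_step.
  split => [[_ E1 E2]|[E1 E2]].
    split => [v|K].
      by have := E1 v; rewrite lamE /l => <-; ring.
    apply/eqP; rewrite -subr_eq0; apply/eqP.
    exact: E2.
  split=> [//|v|w]; first by rewrite lamE; have := E1 v; rewrite /l; lra.
  move=> /(broken_poly0P Xdisj)[d ->]; rewrite !ip_step// -sumrB big1// => K _.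
  by rewrite -mulrBr [X in X - _](E2 K) subrr mulr0.
have [u [c uc]] := mixed_solution_exists normV_norm a_sym Ccoerc_gt0 a_coerc a_cont
  q_scalar q_dual l_scalar alphaV_gt0 g_cont g_mono.
exists (u, step X c); split => [|[u' psi'] /= [psiW E1 E2]]; first exact/equiv.
have [c' psiE] := (broken_poly0P Xdisj psi').1 psiW.
move: psiW E1 E2; rewrite {}psiE => psiW E1 E2.
have uc' := (equiv u' c').1 (And3 psiW E1 E2).
by have [-> ->] := mixed_solution_unique normV_norm Ccoerc_gt0 a_coerc
  q_scalar q_dual alphaV_gt0 g_mono uc uc'.
Qed.
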